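(* Let $n\ge2$. Every eigenvalue of every standardized Laplacian matrix of order $n$ belongs to the intersection of: (1) the two closed disks of radius $1-1/n$ centered at $1/n$ and at $1-1/n$; (2) the two closed angles (each of opening less than $\pi$), one with vertex $1$ bounded by the two half-lines from $1$ through $e^{-2\pi\mathrm i/n}$ and through $e^{2\pi\mathrm i/n}$, the other with vertex $0$ bounded by the two half-lines from $0$ through $e^{-(\pi/2-\pi/n)\mathrm i}$ and through $e^{(\pi/2-\pi/n)\mathrm i}$; and (3) the band $|\operatorname{Im}z|\le\frac{1}{2n}\cot\frac{\pi}{2n}$.
   Context: A standardized Laplacian matrix of order $n$ is a real $n\times n$ matrix whose row sums are all $0$ and whose off-diagonal entries are nonpositive with absolute value at most $1/n$. *)

(* Defs.v *)
From Stdlib Require Import Reals Lra.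
Open Scope R_scope.

Fixpoint rsum (n : nat) (f : nat -> R) : R :=
  match n with
  | O => 0
  | S k => rsum k f + f k
  end.

Definition standardized_laplacian (n : nat) (L : nat -> nat -> R) : Prop :=
  (forall i, (i < n)%nat -> rsum n (fun j => L i j) = 0) /\
  (forall i j, (i < n)%nat -> (j < n)%nat -> i <> j ->
     L i j <= 0 /\ Rabs (L i j) <= 1 / INR n).

(* The complex number a + b i is an eigenvalue of the real matrix L:
   there is a nonzero complex vector x + i y with L (x + i y) = (a + i b)(x + i y),
   i.e. L x = a x - b y and L y = b x + a y. *)
Definition is_complex_eigenvalue (n : nat) (L : nat -> nat -> R) (a b : R) : Prop :=
  exists x y : nat -> R,
    (exists k, (k < n)%nat /\ (x k <> 0 \/ y k <> 0)) /\
    (forall i, (i < n)%nat ->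
       rsum n (fun j => L i j * x j) = a * x i - b * y i /\
       rsum n (fun j => L i j * y j) = b * x i + a * y i).

Definition in_disk (c r a b : R) : Prop := (a - c)^2 + b^2 <= r^2.

(* Closed angle (opening < pi) with vertex (v1,v2) bounded by the half-lines
   from the vertex through (p1,p2) and through (q1,q2): the convex cone
   spanned at the vertex by the two directions. *)
Definition in_angle (v1 v2 p1 p2 q1 q2 a b : R) : Prop :=
  exists s t : R, 0 <= s /\ 0 <= t /\
    a = v1 + s * (p1 - v1) + t * (q1 - v1) /\
    b = v2 + s * (p2 - v2) + t * (q2 - v2).

Definition cot (x : R) : R := cos x / sin x.

(* Main.v *)
(** Write [z] for an eigenvector of [lambda].

    The disk centered at [1 - 1/n] is Gershgorin's.

    For the angle at 0, [lambda z_i] is a nonnegative combination of the [z_i - z_j], so from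
    every nonzero entry one can pass to a different entry lying beyond the line through
    [z_i] directed by [lambda z_i]. Such a step that turns by [t] changes the modulus by a
    factor of at least [sin th / sin (th + t)], [th = arg lambda]. Closing a cycle of at most
    n steps and using the convexity of [- ln sin] yields [th <= PI/2 - PI/n].

    The band is Pick's bound on imaginary parts: [Im lambda |z|^2] is at most
    [(1/n) sum_{i<j} |Im (conj z_i z_j)|], and this last sum is the area of a centrally
    symmetric 2n-gon with edges [+-z_k], which the discrete isoperimetric inequality
    bounds in terms of the squared edge lengths.

    Finally [I - J/n - L], with [J] the all-ones matrix, is again a standardized Laplacian
    and has the eigenvalue [1 - lambda] when [lambda <> 0]; this gives the other disk and
    the angle at 1. *)

Require Import Defs.
From Stdlib Require Import Reals.
From Stdlib Require Import Lra Lia List Permutation Sorted Classical IndefiniteDescription.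
Open Scope R_scope.

(** * Finite sums *)

Lemma rsum_ext n f g :
  (forall k, (k < n)%nat -> f k = g k) -> rsum n f = rsum n g.
Proof.
  induction n as [|n IH]; simpl; intros H; [reflexivity|].
  rewrite IH by (intros; apply H; lia). rewrite H by lia. reflexivity.
Qed.

Lemma rsum_plus n f g : rsum n (fun k => f k + g k) = rsum n f + rsum n g.
Proof. induction n as [|n IH]; simpl; [|rewrite IH]; ring. Qed.

Lemma rsum_scal n c f : rsum n (fun k => c * f k) = c * rsum n f.
Proof. induction n as [|n IH]; simpl; [|rewrite IH]; ring. Qed.

Lemma rsum_const n c : rsum n (fun _ => c) = INR n * c.
Proof. induction n as [|n IH]; [simpl|rewrite S_INR; simpl; rewrite IH]; ring. Qed.

Lemma rsum_le n f g :
  (forall k, (k < n)%nat -> f k <= g k) -> rsum n f <= rsum n g.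
Proof.
  induction n as [|n IH]; simpl; intros H; [lra|].
  apply Rplus_le_compat; [apply IH; intros; apply H; lia | apply H; lia].
Qed.

Lemma rsum_nonneg n f :
  (forall k, (k < n)%nat -> 0 <= f k) -> 0 <= rsum n f.
Proof.
  intros H. replace 0 with (rsum n (fun _ => 0)) by (rewrite rsum_const; ring).
  apply rsum_le; exact H.
Qed.

Lemma rsum_nonneg_eq0 n f :
  (forall k, (k < n)%nat -> 0 <= f k) -> rsum n f = 0 ->
  forall k, (k < n)%nat -> f k = 0.
Proof.
  induction n as [|n IH]; simpl; intros H H0 k Hk; [lia|].
  assert (H1 : 0 <= rsum n f) by (apply rsum_nonneg; intros; apply H; lia).
  assert (H2 : 0 <= f n) by (apply H; lia).
  destruct (Nat.eq_dec k n) as [->|Hkn]; [lra|].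
  apply IH; [intros; apply H; lia | lra | lia].
Qed.

Lemma rsum_delta n i (c : R) :
  (i < n)%nat -> rsum n (fun j => if Nat.eqb j i then c else 0) = c.
Proof.
  assert (H0 : forall m, (m <= i)%nat ->
    rsum m (fun j => if Nat.eqb j i then c else 0) = 0).
  { induction m as [|m IH]; simpl; intros Hm; [reflexivity|].
    rewrite IH by lia. destruct (Nat.eqb_spec m i); [lia|ring]. }
  induction n as [|n IH]; simpl; intros Hi; [lia|].
  destruct (Nat.eqb_spec n i) as [->|Hni].
  - rewrite H0 by lia. ring.
  - rewrite IH by lia. ring.
Qed.

Lemma rsum_shift n f : rsum n (fun k => f (S k)) = rsum n f + f n - f O.
Proof. induction n as [|n IH]; simpl; [|rewrite IH]; ring. Qed.

(** Joins the entries at [(i, j)] and [(j, i)], so that an antisymmetric factor can be taken out of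
    each pair. *)
Lemma rsum_square_split n G :
  rsum n (fun i => rsum n (fun j => G i j)) =
  rsum n (fun i => G i i + rsum i (fun j => G i j + G j i)).
Proof.
  induction n as [|n IH]; [reflexivity|].
  simpl. rewrite (rsum_plus n (fun i => rsum n (fun j => G i j))), IH.
  rewrite (rsum_plus n (fun j => G n j)). ring.
Qed.

(** * The discrete isoperimetric inequality *)

(* Minimising over the interior points gives the right-hand side; the minimiser
   is the solution of x_{k+1} + x_{k-1} = 2 cos t x_k with the given end values. *)
Lemma path_wirtinger (t : R) (x : nat -> R) m :
  (forall k, (1 <= k <= S m)%nat -> 0 < sin (INR k * t)) ->
  2 * rsum (S m) (fun k => x k * x (S k)) <=
  2 * cos t * (rsum (S m) (fun k => x k ^ 2) - x O ^ 2) +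
  (sin (INR m * t) * (x O ^ 2 + x (S m) ^ 2) + 2 * sin t * x O * x (S m))
    / sin (INR (S m) * t).
Proof.
  induction m as [|m IH]; intros Hpos.
  - assert (H1 := Hpos 1%nat ltac:(lia)). simpl in *.
    rewrite Rmult_1_l in *. rewrite Rmult_0_l, sin_0.
    apply Req_le. field. lra.
  - assert (IH' := IH ltac:(intros; apply Hpos; lia)); clear IH.
    assert (H1 := Hpos (S m) ltac:(lia)).
    assert (H2 := Hpos (S (S m)) ltac:(lia)).
    change (rsum (S (S m)) (fun k => x k * x (S k)))
      with (rsum (S m) (fun k => x k * x (S k)) + x (S m) * x (S (S m))).
    change (rsum (S (S m)) (fun k => x k ^ 2))
      with (rsum (S m) (fun k => x k ^ 2) + x (S m) ^ 2).
    set (u := x O) in *. set (v := x (S m)) in *. set (w := x (S (S m))) in *.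
    set (A := rsum (S m) (fun k => x k * x (S k))) in *.
    set (B := rsum (S m) (fun k => x k ^ 2)) in *.
    assert (E2 : sin (INR (S (S m)) * t)
                 = sin (INR (S m) * t) * cos t + cos (INR (S m) * t) * sin t).
    { rewrite <- sin_plus. f_equal. rewrite (S_INR (S m)). ring. }
    assert (E0 : sin (INR m * t)
                 = sin (INR (S m) * t) * cos t - cos (INR (S m) * t) * sin t).
    { rewrite <- sin_minus. f_equal. rewrite (S_INR m). ring. }
    assert (Q1 := sin2_cos2 t). assert (Q2 := sin2_cos2 (INR (S m) * t)).
    unfold Rsqr in Q1, Q2.
    set (s0 := sin (INR m * t)) in *. set (s1 := sin (INR (S m) * t)) in *.
    set (s2 := sin (INR (S (S m)) * t)) in *. set (c1 := cos (INR (S m) * t)) in *.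
    set (s := sin t) in *. set (c := cos t) in *.
    (* The bound for [S m] minus that for [m] exceeds the new term [2 * (v * w)] by a square over a
       positive number, which closes the induction. *)
    assert (D : 2 * c * v ^ 2 + (s1 * (u ^ 2 + w ^ 2) + 2 * s * u * w) / s2
      - (s0 * (u ^ 2 + v ^ 2) + 2 * s * u * v) / s1 - 2 * (v * w)
      = (s2 * v - s1 * w - s * u) ^ 2 / (s1 * s2)).
    { apply (Rmult_eq_reg_r (s1 * s2)); [|nra].
      replace ((2 * c * v ^ 2 + (s1 * (u ^ 2 + w ^ 2) + 2 * s * u * w) / s2
        - (s0 * (u ^ 2 + v ^ 2) + 2 * s * u * v) / s1 - 2 * (v * w)) * (s1 * s2))
        with (2 * c * v ^ 2 * s1 * s2 + s1 * (s1 * (u ^ 2 + w ^ 2) + 2 * s * u * w)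
        - s2 * (s0 * (u ^ 2 + v ^ 2) + 2 * s * u * v) - 2 * (v * w) * s1 * s2)
        by (field; lra).
      replace ((s2 * v - s1 * w - s * u) ^ 2 / (s1 * s2) * (s1 * s2))
        with ((s2 * v - s1 * w - s * u) ^ 2) by (field; lra).
      assert (S02 : s0 * s2 = s1 * s1 - s * s) by (rewrite E0, E2; nra).
      assert (SS : s2 + s0 = 2 * c * s1) by (rewrite E0, E2; ring).
      assert (Hs : 2 * c * s1 * s2 = s2 * s2 + s0 * s2) by (rewrite <- SS; ring).
      replace (2 * c * v ^ 2 * s1 * s2) with (v ^ 2 * (2 * c * s1 * s2)) by ring.
      rewrite Hs.
      replace (s2 * (s0 * (u ^ 2 + v ^ 2) + 2 * s * u * v))
        with (s0 * s2 * (u ^ 2 + v ^ 2) + 2 * s * u * v * s2) by ring.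
      rewrite S02. ring. }
    assert (D0 : 0 <= (s2 * v - s1 * w - s * u) ^ 2 / (s1 * s2)).
    { apply Rmult_le_pos; [apply pow2_ge_0|].
      apply Rlt_le, Rinv_0_lt_compat, Rmult_lt_0_compat; assumption. }
    lra.
Qed.

Lemma sin_multiple_pos n k :
  (1 <= k < n)%nat -> 0 < sin (INR k * (PI / INR n)).
Proof.
  intros Hk. assert (Hn : 0 < INR n) by (apply lt_0_INR; lia).
  assert (H1 : 0 < INR k) by (apply lt_0_INR; lia).
  assert (H2 : INR k < INR n) by (apply lt_INR; lia).
  assert (HP := PI_RGT_0).
  assert (Hi : 0 < / INR n) by (apply Rinv_0_lt_compat; lra).
  apply sin_gt_0.
  - apply Rmult_lt_0_compat; [|apply Rdiv_lt_0_compat]; assumption.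
  - replace PI with (INR n * (PI / INR n)) at 2 by (field; lra).
    apply Rmult_lt_compat_r; [apply Rmult_lt_0_compat; assumption | assumption].
Qed.

(** For t = PI/n one has sin ((n-1)t) = sin t and sin ((n-2)t) = sin 2t. This makes the boundary
    term of [path_wirtinger] explicit, and its mixed product cancels the last summand because
    [x n = - x O]. *)
Lemma antiperiodic_wirtinger n (x : nat -> R) :
  (2 <= n)%nat -> x n = - x O ->
  rsum n (fun k => x k * x (S k)) <= cos (PI / INR n) * rsum n (fun k => x k ^ 2).
Proof.
  intros Hn Hx. destruct n as [|[|m]]; try lia.
  set (t := PI / INR (S (S m))).
  assert (H := path_wirtinger t x m).
  assert (Hp : forall k, (1 <= k <= S m)%nat -> 0 < sin (INR k * t))
    by (intros k Hk; apply sin_multiple_pos; lia).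
  specialize (H Hp).
  assert (Hpos : INR (S (S m)) <> 0) by (apply not_0_INR; lia).
  assert (E1 : sin (INR (S m) * t) = sin t).
  { rewrite <- sin_PI_x. f_equal. unfold t. rewrite (S_INR (S m)) in *. field. lra. }
  assert (E2 : sin (INR m * t) = 2 * sin t * cos t).
  { rewrite <- sin_2a, <- sin_PI_x. f_equal. unfold t.
    rewrite (S_INR (S m)), (S_INR m) in *. field. lra. }
  assert (Ht : 0 < sin t) by (rewrite <- E1; apply Hp; lia).
  rewrite E1, E2 in H.
  change (rsum (S (S m)) (fun k => x k * x (S k)))
    with (rsum (S m) (fun k => x k * x (S k)) + x (S m) * x (S (S m))).
  change (rsum (S (S m)) (fun k => x k ^ 2))
    with (rsum (S m) (fun k => x k ^ 2) + x (S m) ^ 2).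
  rewrite Hx.
  set (A := rsum (S m) (fun k => x k * x (S k))) in *.
  set (B := rsum (S m) (fun k => x k ^ 2)) in *.
  replace ((2 * sin t * cos t * (x 0%nat ^ 2 + x (S m) ^ 2)
            + 2 * sin t * x 0%nat * x (S m)) / sin t)
    with (2 * cos t * (x 0%nat ^ 2 + x (S m) ^ 2) + 2 * x 0%nat * x (S m)) in H
    by (field; lra).
  lra.
Qed.

(* The left side is the signed area of the centrally symmetric 2n-gon with
   successive edges (X k, Y k) and their opposites, vertices (P k, Q k). *)
Lemma ordered_cross_sum_le n (X Y : nat -> R) :
  (2 <= n)%nat ->
  rsum n (fun k => rsum k (fun i => X i * Y k - Y i * X k)) <=
  1 / 2 * cot (PI / (2 * INR n)) * rsum n (fun k => X k ^ 2 + Y k ^ 2).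
Proof.
  intros Hn.
  (* Subtracting half of the total puts the centre of symmetry at the origin, so vertex n is
     opposite to vertex 0. *)
  set (P := fun k => rsum k X - rsum n X / 2).
  set (Q := fun k => rsum k Y - rsum n Y / 2).
  assert (EX : forall k, X k = P (S k) - P k) by (intros; unfold P; simpl; ring).
  assert (EY : forall k, Y k = Q (S k) - Q k) by (intros; unfold Q; simpl; ring).
  assert (HP : P n = - P O) by (unfold P; simpl; field).
  assert (HQ : Q n = - Q O) by (unfold Q; simpl; field).
  assert (EA : rsum n (fun k => rsum k (fun i => X i * Y k - Y i * X k)) =
               rsum n (fun k => P k * Q (S k) - Q k * P (S k))).
  { transitivity (rsum n (fun k => rsum k X * Y k + (-1) * (rsum k Y * X k))).
    - apply rsum_ext. intros k _.
      rewrite (rsum_ext k _ (fun i => Y k * X i + (- X k) * Y i)) by (intros; ring).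
      rewrite rsum_plus, !rsum_scal. ring.
    - rewrite (rsum_ext n (fun k => P k * Q (S k) - Q k * P (S k))
        (fun k => (rsum k X * Y k + (-1) * (rsum k Y * X k)) +
                  ((- (rsum n X / 2)) * Y k + (rsum n Y / 2) * X k))).
      + rewrite (rsum_plus n (fun k => rsum k X * Y k + -1 * (rsum k Y * X k))).
        rewrite (rsum_plus n (fun k => - (rsum n X / 2) * Y k)), !rsum_scal. field.
      + intros k _. unfold P, Q. simpl. ring. }
  rewrite EA. clear EA.
  assert (WP := antiperiodic_wirtinger n P Hn HP).
  assert (WQ := antiperiodic_wirtinger n Q Hn HQ).
  assert (SP := rsum_shift n (fun k => P k ^ 2)). simpl in SP.
  assert (SQ := rsum_shift n (fun k => Q k ^ 2)). simpl in SQ.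
  rewrite HP in SP. rewrite HQ in SQ.
  set (c := cos (PI / INR n)) in *.
  set (s := sin (PI / INR n)).
  assert (EU : rsum n (fun k => X k ^ 2 + Y k ^ 2) =
    2 * (rsum n (fun k => P k ^ 2) + rsum n (fun k => Q k ^ 2)
         - rsum n (fun k => P k * P (S k)) - rsum n (fun k => Q k * Q (S k)))).
  { rewrite (rsum_ext n _ (fun k => (P (S k) * (P (S k) * 1) + P k ^ 2 + (-2) * (P k * P (S k))) +
      (Q (S k) * (Q (S k) * 1) + Q k ^ 2 + (-2) * (Q k * Q (S k)))))
      by (intros k _; rewrite EX, EY; ring).
    rewrite !rsum_plus, !rsum_scal. rewrite SP, SQ. simpl. ring. }
  (* Each vertex is compared with the previous one rotated by PI/n. Expanding the squares gives s A
     <= N - c B, where N is the sum of the squared radii and B that of the inner products of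
     consecutive vertices. *)
  assert (ER : 0 <= rsum n (fun k => (P (S k) - (c * P k - s * Q k)) ^ 2
                             + (Q (S k) - (s * P k + c * Q k)) ^ 2)).
  { apply rsum_nonneg. intros k _. apply Rplus_le_le_0_compat; apply pow2_ge_0. }
  assert (CS : s * s + c * c = 1) by apply sin2_cos2.
  rewrite (rsum_ext n _ (fun k =>
     (P (S k) * (P (S k) * 1) + Q (S k) * (Q (S k) * 1) + (P k ^ 2 + Q k ^ 2)) +
     ((-2 * c) * (P k * P (S k) + Q k * Q (S k))
     + (-2 * s) * (P k * Q (S k) - Q k * P (S k))))) in ER.
  2: { intros k _. set (p := P (S k)). set (q := Q (S k)).
       transitivity (p * p + q * q + (s * s + c * c) * (P k ^ 2 + Q k ^ 2)
         + (-2 * c) * (P k * p + Q k * q) + (-2 * s) * (P k * q - Q k * p));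
       [ring | rewrite CS; ring]. }
  rewrite !rsum_plus, !rsum_scal, !rsum_plus in ER. rewrite SP, SQ in ER.
  rewrite EU.
  set (A := rsum n (fun k => P k * Q (S k) - Q k * P (S k))) in *.
  change (rsum n (fun k => P k * (P k * 1))) with (rsum n (fun k => P k ^ 2)) in *.
  change (rsum n (fun k => Q k * (Q k * 1))) with (rsum n (fun k => Q k ^ 2)) in *.
  set (NP := rsum n (fun k => P k ^ 2)) in *. set (NQ := rsum n (fun k => Q k ^ 2)) in *.
  set (BP := rsum n (fun k => P k * P (S k))) in *.
  set (BQ := rsum n (fun k => Q k * Q (S k))) in *.
  assert (Hpos : 0 < INR n) by (apply lt_0_INR; lia).
  assert (Hs : 0 < s).
  { unfold s. rewrite <- (Rmult_1_l (PI / INR n)). apply (sin_multiple_pos n 1). lia. }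
  set (h := PI / (2 * INR n)).
  assert (Eh : PI / INR n = 2 * h) by (unfold h; field; lra).
  assert (Es : s = 2 * sin h * cos h) by (unfold s; rewrite Eh; apply sin_2a).
  assert (Ec : c = 2 * cos h * cos h - 1) by (unfold c; rewrite Eh; apply cos_2a_cos).
  assert (Hsh : sin h <> 0) by (intros E; rewrite E in Es; lra).
  apply (Rmult_le_reg_l s); [assumption|].
  replace (s * (1 / 2 * cot h * (2 * (NP + NQ - BP - BQ))))
    with ((1 + c) * (NP + NQ - BP - BQ))
    by (unfold cot; rewrite Es, Ec; field; assumption).
  (* Wirtinger gives B <= c N, and (N - c B) + (c N - B) = (1 + c)(N - B). *)
  nra.
Qed.

(** * Polar coordinates *)

Lemma polar_upper u v :
  0 < v -> exists r t, 0 < r /\ 0 < t < PI /\ u = r * cos t /\ v = r * sin t.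
Proof.
  intros Hv. set (t := PI / 2 - atan (u / v)).
  assert (Hb := atan_bound (u / v)).
  assert (Ht : 0 < t < PI) by (unfold t; lra).
  assert (Hs : 0 < sin t) by (apply sin_gt_0; lra).
  assert (Ec : cos t = u / v * sin t).
  { unfold t. rewrite cos_shift, sin_shift.
    assert (Hc : 0 < cos (atan (u / v))) by (apply cos_gt_0; lra).
    rewrite <- (tan_atan (u / v)) at 2. unfold tan. field. lra. }
  exists (v / sin t), t. repeat split; try lra.
  - apply Rdiv_lt_0_compat; assumption.
  - rewrite Ec. field. lra.
  - field. lra.
Qed.

(** The radius may be negative: this exchanges a vector for its opposite and keeps every argument in
    [0, PI]. *)
Lemma polar_signed u v :
  exists r t, 0 <= t <= PI /\ u = r * cos t /\ v = r * sin t.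
Proof.
  assert (HP := PI_RGT_0).
  destruct (Rtotal_order v 0) as [Hv|[->|Hv]].
  - destruct (polar_upper (- u) (- v)) as (r & t & _ & Ht & Hu & Hw); [lra|].
    exists (- r), t. repeat split; lra.
  - exists u, 0. rewrite cos_0, sin_0. repeat split; lra.
  - destruct (polar_upper u v Hv) as (r & t & _ & Ht & Hu & Hw).
    exists r, t. repeat split; lra.
Qed.

(** * Pick's inequality *)

Fixpoint lsum {A : Type} (f : A -> R) (l : list A) : R :=
  match l with nil => 0 | p :: l' => f p + lsum f l' end.

Fixpoint pair_sum {A : Type} (f : A -> A -> R) (l : list A) : R :=
  match l with nil => 0 | p :: l' => lsum (f p) l' + pair_sum f l' end.

(* The list [v (n - 1) :: ... :: v 0], so that consing matches the recursion of [rsum]. *)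
Fixpoint rev_list {A : Type} (n : nat) (v : nat -> A) : list A :=
  match n with O => nil | S k => v k :: rev_list k v end.

Lemma lsum_rev_list {A : Type} (f : A -> R) n v :
  lsum f (rev_list n v) = rsum n (fun k => f (v k)).
Proof. induction n as [|n IH]; simpl; [|rewrite IH]; ring. Qed.

Lemma pair_sum_rev_list {A : Type} (f : A -> A -> R) n v :
  pair_sum f (rev_list n v) = rsum n (fun k => rsum k (fun i => f (v k) (v i))).
Proof. induction n as [|n IH]; simpl; [|rewrite IH, lsum_rev_list]; ring. Qed.

Lemma rev_list_ext {A : Type} n (v w : nat -> A) :
  (forall k, (k < n)%nat -> v k = w k) -> rev_list n v = rev_list n w.
Proof.
  induction n as [|n IH]; simpl; intros H; [reflexivity|].
  rewrite IH by (intros; apply H; lia). rewrite H by lia. reflexivity.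
Qed.

Lemma rev_list_length {A : Type} n (v : nat -> A) : length (rev_list n v) = n.
Proof. induction n as [|n IH]; simpl; congruence. Qed.

(** Serves to read a sorted list back as an indexed family, to which the lemmas on [rsum] apply. *)
Lemma rev_list_surj {A : Type} (a : A) (l : list A) : exists v, rev_list (length l) v = l.
Proof.
  induction l as [|p l [v Hv]]; [exists (fun _ => a); reflexivity|].
  exists (fun k => if Nat.eqb k (length l) then p else v k).
  simpl. rewrite Nat.eqb_refl. f_equal. rewrite <- Hv at 2.
  apply rev_list_ext. intros k Hk. destruct (Nat.eqb_spec k (length l)); [lia|reflexivity].
Qed.

Lemma in_rev_list {A : Type} n (v : nat -> A) k : (k < n)%nat -> In (v k) (rev_list n v).
Proof.
  induction n as [|n IH]; simpl; intros Hk; [lia|].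
  destruct (Nat.eq_dec k n) as [->|]; [left; reflexivity | right; apply IH; lia].
Qed.

Lemma rev_list_in {A : Type} n (v : nat -> A) p :
  In p (rev_list n v) -> exists k, (k < n)%nat /\ v k = p.
Proof.
  induction n as [|n IH]; simpl; [contradiction|].
  intros [H|H]; [exists n; split; [lia|assumption]|].
  destruct (IH H) as (k & Hk & E). exists k. split; [lia|assumption].
Qed.

Lemma lsum_perm {A : Type} (f : A -> R) l l' : Permutation l l' -> lsum f l = lsum f l'.
Proof. induction 1; simpl; lra. Qed.

Lemma pair_sum_perm {A : Type} (f : A -> A -> R) l l' :
  (forall p q, f p q = f q p) -> Permutation l l' -> pair_sum f l = pair_sum f l'.
Proof.
  intros Hf. induction 1; simpl; try lra.
  - rewrite (lsum_perm _ _ _ H). lra.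
  - rewrite (Hf y x). lra.
Qed.

(** One step of insertion sort. The order decreases along the list because [rev_list] puts the
    largest index first, so the key grows with the index. *)
Lemma insert_strongly_sorted {A : Type} (key : A -> R) p l :
  StronglySorted (fun p q => key q <= key p) l ->
  exists l', Permutation (p :: l) l' /\ StronglySorted (fun p q => key q <= key p) l'.
Proof.
  induction l as [|q l IH]; intros Hs.
  - exists (p :: nil). split; [reflexivity|]. repeat constructor.
  - destruct (Rle_dec (key q) (key p)) as [Hle|Hle].
    + exists (p :: q :: l). split; [reflexivity|]. constructor; [assumption|].
      constructor; [assumption|]. apply StronglySorted_inv in Hs as [_ Hf].
      eapply Forall_impl; [|exact Hf]. simpl. intros; lra.
    + apply StronglySorted_inv in Hs as [Hs Hf].
      destruct (IH Hs) as (l' & Hp & Hs'). exists (q :: l'). split.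
      * rewrite perm_swap. constructor. assumption.
      * constructor; [assumption|]. apply (Permutation_Forall Hp).
        constructor; [lra|assumption].
Qed.

Lemma exists_strongly_sorted {A : Type} (key : A -> R) l :
  exists l', Permutation l l' /\ StronglySorted (fun p q => key q <= key p) l'.
Proof.
  induction l as [|p l (l1 & Hp1 & Hs1)].
  - exists nil. split; constructor.
  - destruct (insert_strongly_sorted key p l1 Hs1) as (l' & Hp & Hs).
    exists l'. split; [|assumption]. rewrite <- Hp. constructor. assumption.
Qed.

Lemma rev_list_sorted {A : Type} (key : A -> R) n v :
  StronglySorted (fun p q => key q <= key p) (rev_list n v) ->
  forall i k, (i < k < n)%nat -> key (v i) <= key (v k).
Proof.
  induction n as [|n IH]; simpl; intros Hs i k Hik; [lia|].
  apply StronglySorted_inv in Hs as [Hs Hf].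
  destruct (Nat.eq_dec k n) as [->|]; [|apply IH; [assumption|lia]].
  rewrite Forall_forall in Hf. apply Hf, in_rev_list. lia.
Qed.

(* Replacing a vector by its opposite keeps [|cross|], so all arguments may be
   taken in [0, PI]; after sorting them every cross product is nonnegative. *)
Lemma abs_cross_sum_le n (x y : nat -> R) :
  (2 <= n)%nat ->
  rsum n (fun k => rsum k (fun i => Rabs (x i * y k - y i * x k))) <=
  1 / 2 * cot (PI / (2 * INR n)) * rsum n (fun k => x k ^ 2 + y k ^ 2).
Proof.
  intros Hn.
  destruct (functional_choice (fun k (p : R * R) =>
    0 <= snd p <= PI /\ x k = fst p * cos (snd p) /\ y k = fst p * sin (snd p)))
    as [v Hv].
  { intros k. destruct (polar_signed (x k) (y k)) as (r & t & H). exists (r, t). exact H. }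
  set (f := fun p q : R * R => Rabs (fst p) * Rabs (fst q) * Rabs (sin (snd p - snd q))).
  assert (Hf : forall p q, f p q = f q p).
  { intros p q. unfold f. rewrite <- (Rabs_Ropp (sin (snd q - snd p))), <- sin_neg.
    rewrite Ropp_minus_distr. ring. }
  rewrite (rsum_ext n _ (fun k => rsum k (fun i => f (v k) (v i)))).
  2: { intros k _. apply rsum_ext. intros i _. unfold f.
       destruct (Hv k) as (_ & -> & ->). destruct (Hv i) as (_ & -> & ->).
       rewrite <- !Rabs_mult, sin_minus. f_equal. ring. }
  rewrite (rsum_ext n (fun k => x k ^ 2 + y k ^ 2) (fun k => fst (v k) ^ 2)).
  2: { intros k _. destruct (Hv k) as (_ & -> & ->).
       assert (H := sin2_cos2 (snd (v k))). unfold Rsqr in H. nra. }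
  rewrite <- pair_sum_rev_list, <- (lsum_rev_list (fun p => fst p ^ 2) n v).
  destruct (exists_strongly_sorted snd (rev_list n v)) as (l & Hp & Hs).
  rewrite (pair_sum_perm f _ _ Hf Hp), (lsum_perm _ _ _ Hp).
  assert (Hl : length l = n).
  { rewrite <- (Permutation_length Hp). apply rev_list_length. }
  destruct (rev_list_surj (0, 0) l) as [w Hw]. rewrite Hl in Hw.
  assert (Hwb : forall k, (k < n)%nat -> 0 <= snd (w k) <= PI).
  { intros k Hk. assert (Hin := in_rev_list n w k Hk). rewrite Hw in Hin.
    apply (Permutation_in _ (Permutation_sym Hp)) in Hin.
    apply rev_list_in in Hin as (j & _ & <-). apply Hv. }
  rewrite <- Hw in Hs |- *. assert (Hso := rev_list_sorted _ _ _ Hs).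
  rewrite pair_sum_rev_list, lsum_rev_list.
  (* Radii are replaced by their absolute values: lengths and sorted arguments stay the same. *)
  rewrite (rsum_ext n (fun k => fst (w k) ^ 2)
    (fun k => (Rabs (fst (w k)) * cos (snd (w k))) ^ 2
            + (Rabs (fst (w k)) * sin (snd (w k))) ^ 2)).
  2: { intros k _. rewrite <- (pow2_abs (fst (w k))).
       assert (H := sin2_cos2 (snd (w k))). unfold Rsqr in H. nra. }
  eapply Rle_trans; [|apply ordered_cross_sum_le; assumption].
  apply Req_le, rsum_ext. intros k Hk. apply rsum_ext. intros i Hi. unfold f.
  assert (H1 := Hwb k Hk). assert (H2 := Hwb i ltac:(lia)).
  assert (H3 := Hso i k ltac:(lia)).
  rewrite (Rabs_pos_eq (sin _)) by (apply sin_ge_0; lra).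
  rewrite sin_minus. ring.
Qed.

(** * The band and the disk *)

(** Row [i] of L z = lambda z times the conjugate of z_i, split into real and imaginary parts. *)
Lemma rsum_eigen_cross n (L : nat -> nat -> R) a b x y i :
  rsum n (fun j => L i j * x j) = a * x i - b * y i ->
  rsum n (fun j => L i j * y j) = b * x i + a * y i ->
  rsum n (fun j => L i j * (x i * x j + y i * y j)) = a * (x i ^ 2 + y i ^ 2) /\
  rsum n (fun j => L i j * (x i * y j - y i * x j)) = b * (x i ^ 2 + y i ^ 2).
Proof.
  intros Hx Hy. split.
  - rewrite (rsum_ext n _ (fun j => x i * (L i j * x j) + y i * (L i j * y j)))
      by (intros; ring).
    rewrite rsum_plus, !rsum_scal, Hx, Hy. ring.
  - rewrite (rsum_ext n _ (fun j => x i * (L i j * y j) + (- y i) * (L i j * x j)))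
      by (intros; ring).
    rewrite rsum_plus, !rsum_scal, Hx, Hy. ring.
Qed.

Lemma eigenvalue_band n L a b :
  (2 <= n)%nat -> standardized_laplacian n L -> is_complex_eigenvalue n L a b ->
  Rabs b <= 1 / (2 * INR n) * cot (PI / (2 * INR n)).
Proof.
  intros Hn [_ HL] (x & y & (k0 & Hk0 & Hnz) & He).
  assert (HnR : 0 < INR n) by (apply lt_0_INR; lia).
  set (N := rsum n (fun k => x k ^ 2 + y k ^ 2)).
  assert (Hpos : forall k, 0 <= x k ^ 2 + y k ^ 2) by (intros; nra).
  assert (HN : 0 < N).
  { assert (H : 0 <= N) by (apply rsum_nonneg; auto).
    destruct (Req_dec N 0) as [E|]; [|lra].
    assert (E0 := rsum_nonneg_eq0 n _ (fun k _ => Hpos k) E k0 Hk0). simpl in E0. nra. }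
  (* The imaginary parts are summed over all rows; since the cross product is antisymmetric, each
     pair contributes a difference of two entries of [L]. *)
  assert (Eb : b * N = rsum n (fun k => rsum k (fun i => (L i k - L k i) * (x i * y k - y i * x k)))).
  { unfold N. rewrite <- rsum_scal.
    transitivity (rsum n (fun i => rsum n (fun j => L i j * (x i * y j - y i * x j)))).
    - apply rsum_ext. intros i Hi. destruct (He i Hi) as [Hx Hy].
      symmetry. apply (rsum_eigen_cross n L a b x y i Hx Hy).
    - rewrite rsum_square_split. apply rsum_ext. intros k _.
      replace (L k k * (x k * y k - y k * x k)) with 0 by ring. rewrite Rplus_0_l.
      apply rsum_ext. intros; ring. }
  (* Both entries lie in [-1/n, 0], so they differ by at most 1/n. *)
  assert (Hbound : forall i k, (i < k < n)%nat ->
    Rabs ((L i k - L k i) * (x i * y k - y i * x k))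
    <= 1 / INR n * Rabs (x i * y k - y i * x k)).
  { intros i k Hik. rewrite Rabs_mult. apply Rmult_le_compat_r; [apply Rabs_pos|].
    destruct (HL i k) as [H1 H2]; [lia..|]. destruct (HL k i) as [H3 H4]; [lia..|].
    rewrite Rabs_left1 in H2, H4 by assumption. apply Rabs_le. lra. }
  assert (HA := abs_cross_sum_le n x y Hn). fold N in HA.
  assert (Habs : Rabs b * N <= 1 / INR n *
    rsum n (fun k => rsum k (fun i => Rabs (x i * y k - y i * x k)))).
  { rewrite <- (Rabs_pos_eq N) by lra. rewrite <- Rabs_mult, Eb.
    rewrite <- rsum_scal. apply Rabs_le. split.
    - rewrite <- (Ropp_involutive (rsum n (fun k => rsum k (fun i =>
        (L i k - L k i) * (x i * y k - y i * x k))))).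
      apply Ropp_le_contravar.
      replace (- rsum n (fun k => rsum k (fun i => (L i k - L k i) * (x i * y k - y i * x k))))
        with ((-1) * rsum n (fun k => rsum k (fun i => (L i k - L k i) * (x i * y k - y i * x k))))
        by ring.
      rewrite <- rsum_scal. apply rsum_le. intros k Hk. rewrite <- !rsum_scal.
      apply rsum_le. intros i Hi. assert (H := Hbound i k ltac:(lia)).
      unfold Rabs at 1 in H; destruct Rcase_abs in H; lra.
    - apply rsum_le. intros k Hk. rewrite <- rsum_scal.
      apply rsum_le. intros i Hi. assert (H := Hbound i k ltac:(lia)).
      unfold Rabs at 1 in H; destruct Rcase_abs in H; lra. }
  apply (Rmult_le_reg_r N); [assumption|].
  eapply Rle_trans; [exact Habs|].
  replace (1 / (2 * INR n) * cot (PI / (2 * INR n)) * N)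
    with (1 / INR n * (1 / 2 * cot (PI / (2 * INR n)) * N)) by (field; lra).
  apply Rmult_le_compat_l; [|assumption].
  apply Rlt_le, Rdiv_lt_0_compat; lra.
Qed.

Lemma exists_argmax n (f : nat -> R) :
  (1 <= n)%nat -> exists i, (i < n)%nat /\ forall j, (j < n)%nat -> f j <= f i.
Proof.
  induction n as [|n IH]; intros Hn; [lia|].
  destruct n as [|n].
  - exists O. split; [lia|]. intros j Hj. replace j with O by lia. lra.
  - destruct IH as (i & Hi & Hmax); [lia|].
    destruct (Rle_dec (f i) (f (S n))) as [H|H].
    + exists (S n). split; [lia|]. intros j Hj.
      destruct (Nat.eq_dec j (S n)) as [->|]; [lra|].
      specialize (Hmax j ltac:(lia)). lra.
    + exists i. split; [lia|]. intros j Hj.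
      destruct (Nat.eq_dec j (S n)) as [->|]; [lra|]. apply Hmax. lia.
Qed.

(** The diagonal entry is minus the sum of n - 1 off-diagonal entries, each at least -1/n. *)
Lemma laplacian_diag_le n L i :
  standardized_laplacian n L -> (i < n)%nat -> L i i <= 1 - 1 / INR n.
Proof.
  intros [Hrow HL] Hi. assert (HnR : 0 < INR n) by (apply lt_0_INR; lia).
  assert (H : 0 <= rsum n (fun j => (L i j + 1 / INR n) +
     (-1) * (if Nat.eqb j i then L i i + 1 / INR n else 0))).
  { apply rsum_nonneg. intros j Hj. destruct (Nat.eqb_spec j i) as [->|Hji]; [lra|].
    destruct (HL i j) as [H1 H2]; [lia..|]. rewrite Rabs_left1 in H2 by assumption. lra. }
  rewrite rsum_plus, rsum_scal, rsum_plus, rsum_const, rsum_delta in H by assumption.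
  rewrite Hrow in H by assumption.
  replace (INR n * (1 / INR n)) with 1 in H by (field; lra). lra.
Qed.

(* Gershgorin at the row of the largest entry, with every row disk enlarged to the
   common radius [1 - 1/n]. *)
Lemma eigenvalue_disk n L a b :
  (2 <= n)%nat -> standardized_laplacian n L -> is_complex_eigenvalue n L a b ->
  in_disk (1 - 1 / INR n) (1 - 1 / INR n) a b.
Proof.
  intros Hn HL (x & y & (k0 & Hk0 & Hnz) & He).
  destruct (exists_argmax n (fun k => x k ^ 2 + y k ^ 2)) as (i & Hi & Hmax); [lia|].
  simpl in Hmax.
  set (d := 1 - 1 / INR n). set (M := x i ^ 2 + y i ^ 2).
  assert (HM : 0 < M).
  { specialize (Hmax k0 Hk0). unfold M. simpl.
    assert (0 < x k0 * (x k0 * 1) + y k0 * (y k0 * 1)) by nra. lra. }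
  assert (Hd := laplacian_diag_le n L i HL Hi). fold d in Hd.
  destruct HL as [Hrow HL].
  destruct (He i Hi) as [Hx Hy].
  destruct (rsum_eigen_cross n L a b x y i Hx Hy) as [Ea Eb]. fold M in Ea, Eb.
  set (D := (a - d) ^ 2 + b ^ 2).
  assert (HD : 0 <= D) by (apply Rplus_le_le_0_compat; apply pow2_ge_0).
  set (g := sqrt D). assert (Hg : 0 <= g) by apply sqrt_pos.
  assert (Eg : g * g = D) by (apply sqrt_sqrt; assumption).
  (* Row [i] of d I - L: nonnegative weights with sum [d]. *)
  set (w := fun j => (if Nat.eqb j i then d else 0) + (-1) * L i j).
  assert (Hw : forall j, (j < n)%nat -> 0 <= w j).
  { intros j Hj. unfold w. destruct (Nat.eqb_spec j i) as [->|Hji]; [lra|].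
    destruct (HL i j) as [H1 _]; [assumption|assumption|lia|]. lra. }
  assert (Sw : rsum n w = d).
  { unfold w. rewrite rsum_plus, rsum_scal, rsum_delta, Hrow by assumption. ring. }
  (* The weighted sum of the z_j is (d - lambda) z_i; multiply by the conjugates of d - lambda and
     z_i and take real parts. *)
  assert (Sq : D * M = rsum n (fun j => w j *
     (- (a - d) * (x i * x j + y i * y j) - b * (x i * y j - y i * x j)))).
  { rewrite (rsum_ext n _ (fun j => (if Nat.eqb j i then - (a - d) * d * M else 0) +
      ((a - d) * (L i j * (x i * x j + y i * y j)) + b * (L i j * (x i * y j - y i * x j))))).
    - rewrite !rsum_plus, rsum_delta, !rsum_scal, Ea, Eb by assumption. unfold D. ring.
    - intros j _. unfold w, M. destruct (Nat.eqb_spec j i) as [->|]; ring. }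
  assert (Hle : D * M <= d * (g * M)).
  { rewrite Sq, <- Sw, Rmult_comm, <- rsum_scal. apply rsum_le. intros j Hj.
    rewrite (Rmult_comm (g * M)). apply Rmult_le_compat_l; [apply Hw; assumption|].
    assert (HMj : x j ^ 2 + y j ^ 2 <= M) by (apply Hmax; assumption).
    set (p := x i * x j + y i * y j). set (q := x i * y j - y i * x j).
    assert (Epq : p ^ 2 + q ^ 2 = M * (x j ^ 2 + y j ^ 2)) by (unfold p, q, M; ring).
    assert (Hpq : p ^ 2 + q ^ 2 <= M * M) by (rewrite Epq; apply Rmult_le_compat_l; lra).
    assert (Hcs : (- (a - d) * p - b * q) ^ 2 <= (g * M) ^ 2).
    { replace ((g * M) ^ 2) with (D * (M * M)) by (rewrite <- Eg; ring).
      apply Rle_trans with (D * (p ^ 2 + q ^ 2)).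
      - unfold D. assert (0 <= (- (a - d) * q + b * p) ^ 2) by apply pow2_ge_0. lra.
      - apply Rmult_le_compat_l; lra. }
    apply Rnot_lt_le. intros Hlt. assert (0 <= g * M) by (apply Rmult_le_pos; lra). nra. }
  assert (Hgd : g <= d).
  { destruct (Req_dec g 0) as [E|Hg0].
    - rewrite E. rewrite <- Sw. apply rsum_nonneg. assumption.
    - apply (Rmult_le_reg_r (g * M)); [nra|].
      rewrite <- Rmult_assoc, Eg. assumption. }
  unfold in_disk. fold D. rewrite <- Eg. simpl. nra.
Qed.

(** * The angle *)

(* [exp (- c t) (cos t + c sin t)] has derivative [- (1 + c^2) exp (- c t) sin t]. *)
Lemma cos_plus_sin_lt_exp c t :
  - PI < t < PI -> t <> 0 -> cos t + c * sin t < exp (c * t).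
Proof.
  intros Ht Ht0.
  set (h := fun t => exp (- c * t) * (cos t + c * sin t)).
  set (h' := fun t => - (1 + c ^ 2) * exp (- c * t) * sin t).
  assert (Hd : forall u, derivable_pt_lim h u (h' u)).
  { intros u.
    replace (h' u) with ((exp (- c * u) * (- c * 1)) * (cos u + c * sin u)
      + exp (- c * u) * (- sin u + c * cos u)) by (unfold h'; ring).
    apply (derivable_pt_lim_mult (fun t => exp (- c * t)) (fun t => cos t + c * sin t)).
    - apply (derivable_pt_lim_comp (fun t => - c * t) exp).
      + apply (derivable_pt_lim_scal id). apply derivable_pt_lim_id.
      + apply derivable_pt_lim_exp.
    - apply (derivable_pt_lim_plus cos (fun t => c * sin t)).
      + apply derivable_pt_lim_cos.
      + apply (derivable_pt_lim_scal sin). apply derivable_pt_lim_sin. }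
  assert (H0 : h 0 = 1).
  { unfold h. rewrite Rmult_0_r, exp_0, cos_0, sin_0. ring. }
  assert (Hh : h t < 1).
  { destruct (Rtotal_order t 0) as [Hneg|[E|Hpos]]; [|contradiction|].
    - destruct (MVT_cor2 h h' t 0 Hneg (fun u _ => Hd u)) as (u & Hu & Hut).
      assert (Hs : sin u < 0) by (apply sin_lt_0_var; lra).
      assert (He := exp_pos (- c * u)).
      assert (0 < h' u).
      { unfold h'. replace (- (1 + c ^ 2) * exp (- c * u) * sin u)
          with ((1 + c ^ 2) * exp (- c * u) * (- sin u)) by ring.
        apply Rmult_lt_0_compat; [apply Rmult_lt_0_compat|]; nra. }
      assert (0 < h' u * (0 - t)) by (apply Rmult_lt_0_compat; lra). lra.
    - destruct (MVT_cor2 h h' 0 t Hpos (fun u _ => Hd u)) as (u & Hu & Hut).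
      assert (Hs : 0 < sin u) by (apply sin_gt_0; lra).
      assert (He := exp_pos (- c * u)).
      assert (0 < - h' u).
      { unfold h'. replace (- (- (1 + c ^ 2) * exp (- c * u) * sin u))
          with ((1 + c ^ 2) * exp (- c * u) * sin u) by ring.
        apply Rmult_lt_0_compat; [apply Rmult_lt_0_compat|]; nra. }
      assert (0 < - h' u * (t - 0)) by (apply Rmult_lt_0_compat; lra). lra. }
  unfold h in Hh.
  assert (He := exp_pos (c * t)).
  assert (Ee : exp (c * t) * exp (- c * t) = 1).
  { rewrite <- exp_plus. replace (c * t + - c * t) with 0 by ring. apply exp_0. }
  apply (Rmult_lt_compat_l (exp (c * t))) in Hh; [|assumption].
  rewrite <- Rmult_assoc, Ee in Hh. lra.
Qed.

Lemma cos_plus_sin_le_exp c t : - PI < t < PI -> cos t + c * sin t <= exp (c * t).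
Proof.
  intros Ht. destruct (Req_dec t 0) as [->|Ht0].
  - rewrite cos_0, sin_0, !Rmult_0_r, exp_0. lra.
  - apply Rlt_le, cos_plus_sin_lt_exp; assumption.
Qed.

(* The two lower bounds on the modulus are the tangents of the convex function
   [eta |-> ln (sin th / sin eta)] at [eta = th] and at [eta = PI - th], where it vanishes. *)
Lemma polar_step th p q :
  0 < th < PI -> 1 <= p + cot th * q -> ~ (p = 1 /\ q = 0) ->
  exists r t, 0 < r /\ p = r * cos t /\ q = r * sin t /\
    exp (- (cot th * t)) < r /\ exp (cot th * (t + (2 * th - PI))) <= r.
Proof.
  intros Hth Hpq Hne.
  assert (Hs : 0 < sin th) by (apply sin_gt_0; lra).
  assert (Ec : cot th * sin th = cos th) by (unfold cot; field; lra).
  assert (CS := sin2_cos2 th). unfold Rsqr in CS.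
  assert (Hv : 0 < p * sin th + q * cos th).
  { rewrite <- Ec. nra. }
  (* These are the coordinates of (p + i q) e^(i th). By hypothesis the imaginary part is positive,
     so [eta] lies in (0, PI). *)
  destruct (polar_upper (p * cos th - q * sin th) _ Hv) as (r & eta & Hr & Heta & Eu & Ev).
  set (t := eta - th).
  assert (Ep : p = r * cos t).
  { unfold t. rewrite cos_minus.
    replace (r * (cos eta * cos th + sin eta * sin th))
      with (r * cos eta * cos th + r * sin eta * sin th) by ring.
    rewrite <- Eu, <- Ev.
    transitivity (p * (sin th * sin th + cos th * cos th)); [rewrite CS|]; ring. }
  assert (Eq : q = r * sin t).
  { unfold t. rewrite sin_minus.
    replace (r * (sin eta * cos th - cos eta * sin th))
      with (r * sin eta * cos th - r * cos eta * sin th) by ring.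
    rewrite <- Eu, <- Ev.
    transitivity (q * (sin th * sin th + cos th * cos th)); [rewrite CS|]; ring. }
  set (c := cot th) in *.
  (* Equivalent to r >= sin th / sin eta. *)
  assert (Hrc : 1 <= r * (cos t + c * sin t)) by (rewrite Ep, Eq in Hpq; lra).
  exists r, t. repeat split; try assumption.
  - assert (He := exp_pos (c * t)).
    assert (Hlt : 1 < r * exp (c * t)).
    { destruct (Req_dec t 0) as [E|Ht0].
      - rewrite E, cos_0, sin_0 in *. rewrite Rmult_0_r in *. rewrite exp_0.
        assert (r <> 1) by (intros ->; apply Hne; split; lra). lra.
      - assert (H := cos_plus_sin_lt_exp c t ltac:(unfold t; lra) Ht0). nra. }
    rewrite exp_Ropp. apply (Rmult_lt_reg_r (exp (c * t))); [assumption|].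
    rewrite Rinv_l by lra. assumption.
  (* Passing from [t] to [t'] replaces [eta] by [PI - eta], which has the same sine. *)
  - set (t' := PI - 2 * th - t).
    assert (Et : cos t + c * sin t = cos t' + c * sin t').
    { apply (Rmult_eq_reg_l (sin th)); [|lra].
      transitivity (sin (th + t)); [rewrite sin_plus, <- Ec; ring|].
      transitivity (sin (th + t')); [|rewrite sin_plus, <- Ec; ring].
      rewrite <- sin_PI_x. f_equal. unfold t'. ring. }
    assert (H := cos_plus_sin_le_exp c t' ltac:(unfold t', t; lra)).
    assert (He := exp_pos (c * t')).
    replace (c * (t + (2 * th - PI))) with (- (c * t')) by (unfold t'; ring).
    rewrite exp_Ropp. apply (Rmult_le_reg_r (exp (c * t'))); [assumption|].
    rewrite Rinv_l by lra. rewrite Et in Hrc. nra.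
Qed.

(* [- lambda z_i] is a nonnegative combination of the [z_j - z_i], so some [z_j <> z_i]
   lies on the side of the line [z_i + R lambda z_i] away from the origin;
   [p - i q] is the quotient [z_j / z_i]. *)
Lemma eigenvector_step n L a b x y i :
  standardized_laplacian n L -> (i < n)%nat -> 0 < b ->
  rsum n (fun j => L i j * x j) = a * x i - b * y i ->
  rsum n (fun j => L i j * y j) = b * x i + a * y i ->
  0 < x i ^ 2 + y i ^ 2 ->
  exists j p q, (j < n)%nat /\ x j = p * x i + q * y i /\ y j = p * y i - q * x i /\
    1 <= p + a / b * q /\ ~ (p = 1 /\ q = 0).
Proof.
  intros [Hrow HL] Hi Hb Hx Hy HM.
  destruct (rsum_eigen_cross n L a b x y i Hx Hy) as [Ea Eb].
  set (M := x i ^ 2 + y i ^ 2) in *.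
  set (P := fun j => (x i * x j + y i * y j) / M).
  set (Q := fun j => - (x i * y j - y i * x j) / M).
  assert (EP : rsum n (fun j => L i j * P j) = a).
  { rewrite (rsum_ext n _ (fun j => / M * (L i j * (x i * x j + y i * y j))))
      by (intros; unfold P; field; lra).
    rewrite rsum_scal, Ea. field. lra. }
  assert (EQ : rsum n (fun j => L i j * Q j) = - b).
  { rewrite (rsum_ext n _ (fun j => - / M * (L i j * (x i * y j - y i * x j))))
      by (intros; unfold Q; field; lra).
    rewrite rsum_scal, Eb. field. lra. }
  destruct (classic (exists j, (j < n)%nat /\ 1 <= P j + a / b * Q j /\ ~ (P j = 1 /\ Q j = 0)))
    as [(j & Hj & H1 & H2)|Hno].
  - exists j, (P j), (Q j). repeat split; try assumption.
    + unfold P, Q. apply (Rmult_eq_reg_r M); [|lra].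
      transitivity ((x i * x j + y i * y j) * x i - (x i * y j - y i * x j) * y i);
        [unfold M; ring | field; lra].
    + unfold P, Q. apply (Rmult_eq_reg_r M); [|lra].
      transitivity ((x i * x j + y i * y j) * y i + (x i * y j - y i * x j) * x i);
        [unfold M; ring | field; lra].
  - exfalso.
    assert (Hcase : forall j, (j < n)%nat ->
      (P j = 1 /\ Q j = 0) \/ P j + a / b * Q j < 1).
    { intros j Hj. destruct (classic (P j = 1 /\ Q j = 0)) as [|Hne]; [left; assumption|].
      right. apply Rnot_le_lt. intros Hle. apply Hno. exists j. auto. }
    assert (HPi : P i = 1 /\ Q i = 0).
    { unfold P, Q. split; [|field; lra].
      replace (x i * x i + y i * y i) with M by (unfold M; ring). field. lra. }
    (* Nonnegative terms with total 0 + a + (a/b)(-b) = 0. *)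
    assert (Hz : forall j, (j < n)%nat -> - L i j * (1 - P j - a / b * Q j) = 0).
    { apply rsum_nonneg_eq0.
      - intros j Hj. destruct (Nat.eq_dec j i) as [->|Hji].
        + destruct HPi as [-> ->]. lra.
        + destruct (HL i j) as [H1 _]; [lia..|].
          destruct (Hcase j Hj) as [[-> ->]|H2]; [lra|]. nra.
      - rewrite (rsum_ext n _ (fun j => (-1) * L i j + (L i j * P j + a / b * (L i j * Q j))))
          by (intros; ring).
        rewrite !rsum_plus, !rsum_scal, Hrow, EP, EQ by assumption. field. lra. }
    (* Hence every [L i j * Q j] vanishes, although their sum is [- b]. *)
    assert (Hq : rsum n (fun j => L i j * Q j) = rsum n (fun _ => 0)).
    { apply rsum_ext. intros j Hj. specialize (Hz j Hj).
      destruct (Hcase j Hj) as [[_ ->]|H2]; [ring|].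
      apply Rmult_integral in Hz as [Hz|Hz]; [|lra].
      replace (L i j) with 0 by lra. ring. }
    rewrite EQ, rsum_const in Hq. lra.
Qed.

(** The form [p + S m] makes the cycle length positive; looking only at the first n + 1 values keeps
    it at most n. *)
Lemma pigeonhole n (f : nat -> nat) :
  (forall k, (f k < n)%nat) -> exists p m, (p + S m <= n)%nat /\ f p = f (p + S m)%nat.
Proof.
  intros Hf. apply NNPP. intros Hno.
  assert (Hnd : NoDup (map f (seq 0 (S n)))).
  { apply NoDup_map_NoDup_ForallPairs; [|apply seq_NoDup].
    intros p q Hp Hq E. apply in_seq in Hp, Hq.
    destruct (Nat.lt_trichotomy p q) as [H|[H|H]]; [|assumption|]; exfalso; apply Hno.
    - exists p, (q - p - 1)%nat. replace (p + S (q - p - 1))%nat with q by lia. split; [lia|assumption].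
    - exists q, (p - q - 1)%nat. replace (q + S (p - q - 1))%nat with p by lia. split; [lia|auto]. }
  assert (Hle := NoDup_incl_length Hnd (l' := seq 0 n)).
  rewrite length_map, !length_seq in Hle.
  enough (S n <= n)%nat by lia. apply Hle.
  intros j Hj. apply in_map_iff in Hj as (k & <- & _). apply in_seq. specialize (Hf k). lia.
Qed.

Lemma cos_1_sin_0_ge_2PI t : 0 < t -> cos t = 1 -> sin t = 0 -> 2 * PI <= t.
Proof.
  intros Ht Hc Hs. apply Rnot_lt_le. intros Hlt.
  destruct (Rtotal_order t PI) as [H|[->|H]].
  - assert (0 < sin t) by (apply sin_gt_0; lra). lra.
  - rewrite cos_PI in Hc. lra.
  - assert (sin t < 0) by (apply sin_lt_0; lra). lra.
Qed.

(* Following [eigenvector_step] from entry to entry produces a cycle of length at most n.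
   Around it the moduli multiply to 1 and the arguments add up to a multiple of [2 PI]:
   the first bound of [polar_step] makes the multiple positive, the second one bounds
   it by [n (PI - 2 th)]. *)
Lemma eigenvalue_arg_le n L r th :
  standardized_laplacian n L -> 0 < r -> 0 < th < PI / 2 ->
  is_complex_eigenvalue n L (r * cos th) (r * sin th) ->
  2 * PI <= INR n * (PI - 2 * th).
Proof.
  intros HL Hr Hth (x & y & (k0 & Hk0 & Hnz) & He).
  assert (Hs : 0 < sin th) by (apply sin_gt_0; lra).
  assert (Hc : 0 < cos th) by (apply cos_gt_0; lra).
  set (c := cot th).
  assert (Hcpos : 0 < c) by (apply Rdiv_lt_0_compat; assumption).
  set (good := fun i => (i < n)%nat /\ 0 < x i ^ 2 + y i ^ 2).
  (* Here z_j = s e^(-i t) z_i after [m] steps; both bounds survive composition, where the [s]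
     multiply and the [t] add. *)
  set (turn := fun m i j => exists s t, 0 < s /\
    x j = s * cos t * x i + s * sin t * y i /\
    y j = s * cos t * y i - s * sin t * x i /\
    exp (- (c * t)) < s /\ exp (c * (t + INR m * (2 * th - PI))) <= s).
  destruct (functional_choice (fun i j => good i -> good j /\ turn 1%nat i j)) as [next Hnext].
  { intros i. destruct (classic (good i)) as [[Hi HM]|Hng]; [|exists i; contradiction].
    destruct (He i Hi) as [Hx Hy].
    destruct (eigenvector_step n L _ _ x y i HL Hi (Rmult_lt_0_compat _ _ Hr Hs) Hx Hy HM)
      as (j & p & q & Hj & Exj & Eyj & Hpq & Hne).
    replace (r * cos th / (r * sin th)) with (cot th) in Hpq by (unfold cot; field; lra).
    destruct (polar_step th p q ltac:(lra) Hpq Hne) as (s & t & Hs0 & Ep & Eq & H1 & H2).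
    exists j. intros _. split.
    - split; [assumption|]. rewrite Exj, Eyj.
      replace ((p * x i + q * y i) ^ 2 + (p * y i - q * x i) ^ 2)
        with ((p ^ 2 + q ^ 2) * (x i ^ 2 + y i ^ 2)) by ring.
      apply Rmult_lt_0_compat; [|assumption].
      rewrite Ep, Eq. assert (CS := sin2_cos2 t). unfold Rsqr in CS. nra.
    - exists s, t. rewrite <- Ep, <- Eq. simpl INR. rewrite Rmult_1_l. auto. }
  set (f := fix f k := match k with O => k0 | S k' => next (f k') end).
  assert (Hgood : forall k, good (f k)).
  { induction k as [|k IH]; [split; [assumption|simpl; nra]|]. apply Hnext, IH. }
  assert (Hturn : forall p m, turn (S m) (f p) (f (p + S m)%nat)).
  { intros p. induction m as [|m (s & t & Hs0 & Ex & Ey & H1 & H2)].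
    - rewrite Nat.add_1_r. apply (Hnext (f p) (Hgood p)).
    - replace (p + S (S m))%nat with (S (p + S m)) by lia.
      destruct (Hnext _ (Hgood (p + S m)%nat)) as [_ (s' & t' & Hs0' & Ex' & Ey' & H1' & H2')].
      exists (s' * s), (t' + t).
      change (f (S (p + S m))) with (next (f (p + S m)%nat)).
      repeat split.
      + apply Rmult_lt_0_compat; assumption.
      + rewrite Ex', Ex, Ey, cos_plus, sin_plus. ring.
      + rewrite Ey', Ex, Ey, cos_plus, sin_plus. ring.
      + replace (- (c * (t' + t))) with (- (c * t') + - (c * t)) by ring.
        rewrite exp_plus.
        apply Rmult_le_0_lt_compat; try assumption; apply Rlt_le, exp_pos.
      + replace (c * (t' + t + INR (S (S m)) * (2 * th - PI)))
          with (c * (t' + INR 1 * (2 * th - PI)) + c * (t + INR (S m) * (2 * th - PI)))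
          by (rewrite (S_INR (S m)); simpl INR; ring).
        rewrite exp_plus.
        apply Rmult_le_compat; try assumption; apply Rlt_le, exp_pos. }
  destruct (pigeonhole n f (fun k => proj1 (Hgood k))) as (p & m & Hpm & Ef).
  destruct (Hturn p m) as (s & t & Hs0 & Ex & Ey & H1 & H2).
  rewrite <- Ef in Ex, Ey. destruct (Hgood p) as [_ HM].
  set (u := x (f p)) in *. set (v := y (f p)) in *.
  (* Returning to the same nonzero entry forces s e^(-i t) = 1. *)
  assert (Ec : s * cos t = 1).
  { apply (Rmult_eq_reg_r (u ^ 2 + v ^ 2)); [|lra].
    transitivity (u * (s * cos t * u + s * sin t * v) + v * (s * cos t * v - s * sin t * u));
      [ring|]. rewrite <- Ex, <- Ey. ring. }
  assert (Es : s * sin t = 0).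
  { apply (Rmult_eq_reg_r (u ^ 2 + v ^ 2)); [|lra].
    transitivity (v * (s * cos t * u + s * sin t * v) - u * (s * cos t * v - s * sin t * u));
      [ring|]. rewrite <- Ex, <- Ey. ring. }
  assert (Est : sin t = 0) by (apply Rmult_integral in Es as [|]; [lra|assumption]).
  assert (CS := sin2_cos2 t). unfold Rsqr in CS. rewrite Est in CS.
  assert (Es1 : s = 1) by nra. rewrite Es1 in *.
  (* With s = 1 the first bound gives t > 0, hence t >= 2 PI, and the second gives t <= (m+1)(PI - 2
     th). *)
  rewrite <- exp_0 in H1, H2. apply exp_lt_inv in H1.
  assert (Ht : 0 < t) by nra.
  assert (HT := cos_1_sin_0_ge_2PI t Ht ltac:(lra) Est).
  assert (H3 : t + INR (S m) * (2 * th - PI) <= 0).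
  { apply Rnot_lt_le. intros Hlt.
    assert (0 < c * (t + INR (S m) * (2 * th - PI))) by (apply Rmult_lt_0_compat; assumption).
    apply exp_increasing in H. lra. }
  assert (Hmn : INR (S m) <= INR n) by (apply le_INR; lia).
  nra.
Qed.

Lemma eigenvalue_conj n L a b :
  is_complex_eigenvalue n L a b -> is_complex_eigenvalue n L a (- b).
Proof.
  intros (x & y & (k & Hk & Hnz) & He). exists x, (fun i => - y i). split.
  - exists k. split; [assumption|]. destruct Hnz; [left|right]; lra.
  - intros i Hi. destruct (He i Hi) as [Hx Hy]. split; [rewrite Hx; ring|].
    rewrite (rsum_ext n _ (fun j => (-1) * (L i j * y j))) by (intros; ring).
    rewrite rsum_scal, Hy. ring.
Qed.

Lemma pi_div_bounds n : (2 <= n)%nat -> 0 < PI / INR n <= PI / 2.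
Proof.
  intros Hn. assert (H2 : 2 <= INR n) by (apply (le_INR 2); assumption).
  assert (HP := PI_RGT_0). split; [apply Rdiv_lt_0_compat; lra|].
  apply Rmult_le_compat_l; [lra|]. apply Rinv_le_contravar; lra.
Qed.

(** In polar form the claim is cos (th + PI/n) >= 0. The disk forces [a > 0], so th < PI/2 and
    [eigenvalue_arg_le] applies. *)
Lemma eigenvalue_slope_pos n L a b :
  (2 <= n)%nat -> standardized_laplacian n L -> is_complex_eigenvalue n L a b -> 0 < b ->
  b * sin (PI / INR n) <= a * cos (PI / INR n).
Proof.
  intros Hn HL Hab Hb.
  assert (Hd := eigenvalue_disk n L a b Hn HL Hab). unfold in_disk in Hd.
  assert (HnR : 2 <= INR n) by (apply (le_INR 2); assumption).
  assert (Hi : / INR n <= / 2) by (apply Rinv_le_contravar; lra).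
  assert (Ha : 0 < a) by (unfold Rdiv in Hd; nra).
  destruct (polar_upper a b Hb) as (r & th & Hr & Hth & Ea & Eb).
  assert (Hth2 : th < PI / 2).
  { apply Rnot_le_lt. intros H. assert (cos th <= 0) by (apply cos_le_0; lra). nra. }
  assert (Harg : 2 * PI <= INR n * (PI - 2 * th)).
  { apply (eigenvalue_arg_le n L r th HL Hr ltac:(lra)). rewrite <- Ea, <- Eb. assumption. }
  set (h := PI / INR n). assert (Eh : PI = INR n * h) by (unfold h; field; lra).
  assert (Hh := pi_div_bounds n Hn). fold h in Hh.
  assert (Hle : th + h <= PI / 2) by nra.
  assert (Hcos : 0 <= cos (th + h)) by (apply cos_ge_0; lra).
  rewrite cos_plus in Hcos. rewrite Ea, Eb. nra.
Qed.

Lemma eigenvalue_nonneg_real n L a b :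
  (2 <= n)%nat -> standardized_laplacian n L -> is_complex_eigenvalue n L a b -> 0 <= a.
Proof.
  intros Hn HL Hab.
  assert (Hd := eigenvalue_disk n L a b Hn HL Hab). unfold in_disk in Hd.
  assert (HnR : 2 <= INR n) by (apply (le_INR 2); assumption).
  assert (Hi : / INR n <= / 2) by (apply Rinv_le_contravar; lra).
  unfold Rdiv in Hd. nra.
Qed.

Lemma eigenvalue_angle n L a b :
  (2 <= n)%nat -> standardized_laplacian n L -> is_complex_eigenvalue n L a b ->
  in_angle 0 0 (cos (PI / 2 - PI / INR n)) (- sin (PI / 2 - PI / INR n))
               (cos (PI / 2 - PI / INR n)) (sin (PI / 2 - PI / INR n)) a b.
Proof.
  intros Hn HL Hab. rewrite cos_shift, sin_shift.
  assert (Ha := eigenvalue_nonneg_real n L a b Hn HL Hab).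
  assert (Hh := pi_div_bounds n Hn).
  assert (H1 : b * sin (PI / INR n) <= a * cos (PI / INR n)).
  { destruct (Rle_lt_dec b 0) as [Hb|Hb].
    - assert (0 <= cos (PI / INR n)) by (apply cos_ge_0; lra).
      assert (0 <= sin (PI / INR n)) by (apply sin_ge_0; lra). nra.
    - apply (eigenvalue_slope_pos n L); assumption. }
  assert (H2 : - b * sin (PI / INR n) <= a * cos (PI / INR n)).
  { destruct (Rle_lt_dec 0 b) as [Hb|Hb].
    - assert (0 <= cos (PI / INR n)) by (apply cos_ge_0; lra).
      assert (0 <= sin (PI / INR n)) by (apply sin_ge_0; lra). nra.
    - apply (eigenvalue_slope_pos n L); [assumption..| |lra].
      apply eigenvalue_conj; assumption. }
  assert (Hs : 0 < sin (PI / INR n)) by (apply sin_gt_0; lra).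
  assert (Hc : 0 <= cos (PI / INR n)) by (apply cos_ge_0; lra).
  set (s := sin (PI / INR n)) in *. set (c := cos (PI / INR n)) in *.
  (* The cosine vanishes for n = 2: the angle is then the nonnegative real half-line. *)
  destruct (Req_dec c 0) as [Ec|Hc0].
  - assert (b = 0) by nra.
    exists (a / (2 * s)), (a / (2 * s)).
    assert (0 <= a / (2 * s)) by (apply Rmult_le_pos; [lra|apply Rlt_le, Rinv_0_lt_compat; lra]).
    repeat split; try assumption; rewrite ?Ec; [field; lra | lra].
  - assert (Hinv : 0 < / (2 * s * c)) by (apply Rinv_0_lt_compat; nra).
    exists ((a * c - b * s) / (2 * s * c)), ((a * c + b * s) / (2 * s * c)).
    repeat split; try (apply Rmult_le_pos; lra); field; lra.
Qed.

(** * Complementary Laplacian *)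

Definition complement (n : nat) (L : nat -> nat -> R) (i j : nat) : R :=
  (if Nat.eqb j i then 1 else 0) - 1 / INR n - L i j.

(** The map x -> -1/n - x preserves [-1/n, 0], and I, J/n and L have row sums 1, 1 and 0. *)
Lemma complement_laplacian n L :
  standardized_laplacian n L -> standardized_laplacian n (complement n L).
Proof.
  intros [Hrow HL]. split.
  - intros i Hi. assert (HnR : 0 < INR n) by (apply lt_0_INR; lia). unfold complement.
    rewrite (rsum_ext n _ (fun j => (if Nat.eqb j i then 1 else 0) + (- (1 / INR n) + (-1) * L i j)))
      by (intros; ring).
    rewrite !rsum_plus, rsum_delta, rsum_const, rsum_scal, Hrow by assumption. field. lra.
  - intros i j Hi Hj Hij. destruct (HL i j Hi Hj Hij) as [H1 H2].
    rewrite Rabs_left1 in H2 by assumption. unfold complement.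
    destruct (Nat.eqb_spec j i) as [->|_]; [contradiction|].
    split; [lra|]. rewrite Rabs_left1; lra.
Qed.

(** The complement annihilates constant vectors, so the right-hand side does not involve [c]. *)
Lemma complement_mul n L i (x : nat -> R) c :
  standardized_laplacian n L -> (i < n)%nat ->
  rsum n (fun j => complement n L i j * (x j - c)) =
  x i - rsum n x / INR n - rsum n (fun j => L i j * x j).
Proof.
  intros HL Hi. destruct (complement_laplacian n L HL) as [Hrow _].
  assert (HnR : 0 < INR n) by (apply lt_0_INR; lia).
  rewrite (rsum_ext n _ (fun j => ((if Nat.eqb j i then x i else 0)
     + (- (1 / INR n) * x j + (-1) * (L i j * x j))) + (- c) * complement n L i j)).
  - rewrite !rsum_plus, rsum_delta, !rsum_scal by assumption.
    replace (rsum n (complement n L i)) with 0 by (symmetry; exact (Hrow i Hi)). field. lra.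
  - intros j _. unfold complement. destruct (Nat.eqb_spec j i) as [->|]; ring.
Qed.

(* If [lambda <> 1], the vector [z - m / (1 - lambda)], with [m] the mean of the eigenvector
   [z] of [lambda], is an eigenvector of the complement. *)
Lemma complement_eigenvalue n L a b :
  (2 <= n)%nat -> standardized_laplacian n L -> is_complex_eigenvalue n L a b ->
  ~ (a = 0 /\ b = 0) -> is_complex_eigenvalue n (complement n L) (1 - a) (- b).
Proof.
  intros Hn HL (x & y & (k & Hk & Hnz) & He) H0.
  destruct (classic (a = 1 /\ b = 0)) as [[-> ->]|H1].
  - destruct (complement_laplacian n L HL) as [Hrow _].
    exists (fun _ => 1), (fun _ => 0). split; [exists k; split; [assumption|left; lra]|].
    intros i Hi. split.
    + rewrite (rsum_ext n _ (fun j => complement n L i j)) by (intros; ring).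
      rewrite Hrow by assumption. ring.
    + rewrite (rsum_ext n _ (fun _ => 0)) by (intros; ring). rewrite rsum_const. ring.
  - set (D := (1 - a) ^ 2 + b ^ 2).
    assert (HD : D <> 0).
    { intros E. apply H1. unfold D in E.
      assert (0 <= (1 - a) ^ 2) by apply pow2_ge_0. assert (0 <= b ^ 2) by apply pow2_ge_0.
      split; nra. }
    set (mx := rsum n x / INR n). set (my := rsum n y / INR n).
    (* Real and imaginary parts of m / (1 - lambda). *)
    set (cx := (mx * (1 - a) - my * b) / D). set (cy := (mx * b + my * (1 - a)) / D).
    assert (Emx : mx = (1 - a) * cx + b * cy) by (unfold cx, cy, D; field; exact HD).
    assert (Emy : my = (1 - a) * cy - b * cx) by (unfold cx, cy, D; field; exact HD).
    exists (fun i => x i - cx), (fun i => y i - cy). split.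
    (* If the shifted vector were zero, z would be constant, so lambda z = L z = 0 with both lambda
       and z nonzero. *)
    + apply NNPP. intros Hall.
      assert (Hconst : forall i, (i < n)%nat -> x i = cx /\ y i = cy).
      { intros i Hi. split; apply NNPP; intros Hne; apply Hall; exists i;
          (split; [assumption|]); [left|right]; lra. }
      destruct HL as [Hrow _]. destruct (He k Hk) as [Hx Hy].
      rewrite (rsum_ext n _ (fun j => cx * L k j)) in Hx
        by (intros j Hj; destruct (Hconst j Hj) as [-> _]; ring).
      rewrite (rsum_ext n _ (fun j => cy * L k j)) in Hy
        by (intros j Hj; destruct (Hconst j Hj) as [_ ->]; ring).
      assert (Hk0 : rsum n (L k) = 0) by exact (Hrow k Hk).
      rewrite rsum_scal, Hk0 in Hx, Hy.
      assert (Ez : (a ^ 2 + b ^ 2) * (x k ^ 2 + y k ^ 2) = 0).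
      { replace ((a ^ 2 + b ^ 2) * (x k ^ 2 + y k ^ 2))
          with ((a * x k - b * y k) ^ 2 + (b * x k + a * y k) ^ 2) by ring.
        rewrite <- Hx, <- Hy. ring. }
      apply Rmult_integral in Ez as [Ez|Ez].
      * apply H0. split; nra.
      * destruct Hnz; nra.
    + intros i Hi. destruct (He i Hi) as [Hx Hy].
      rewrite !complement_mul by assumption. rewrite Hx, Hy. fold mx my.
      rewrite Emx, Emy. split; ring.
Qed.

(** * Intersection of the disks, the angles and the band *)

Theorem theorem8 (n : nat) (Hn : (2 <= n)%nat) (L : nat -> nat -> R)
  (HL : standardized_laplacian n L) (a b : R)
  (Hab : is_complex_eigenvalue n L a b) :
  (* (1) two disks *)
  in_disk (1 / INR n) (1 - 1 / INR n) a b /\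
  in_disk (1 - 1 / INR n) (1 - 1 / INR n) a b /\
  (* (2) angle with vertex 1 through e^{-2 pi i/n} and e^{2 pi i/n} *)
  in_angle 1 0 (cos (2 * PI / INR n)) (- sin (2 * PI / INR n))
               (cos (2 * PI / INR n)) (sin (2 * PI / INR n)) a b /\
  (* angle with vertex 0 through e^{-(pi/2 - pi/n) i} and e^{(pi/2 - pi/n) i} *)
  in_angle 0 0 (cos (PI / 2 - PI / INR n)) (- sin (PI / 2 - PI / INR n))
               (cos (PI / 2 - PI / INR n)) (sin (PI / 2 - PI / INR n)) a b /\
  (* (3) band *)
  Rabs b <= 1 / (2 * INR n) * cot (PI / (2 * INR n)).
Proof.
  assert (HnR : 2 <= INR n) by (apply (le_INR 2); assumption).
  assert (Hh := pi_div_bounds n Hn).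
  assert (Hs : 0 < sin (PI / INR n)) by (apply sin_gt_0; lra).
  assert (E2 : 2 * PI / INR n = 2 * (PI / INR n)) by (field; lra).
  assert (Hcompl : in_disk (1 / INR n) (1 - 1 / INR n) a b /\
    in_angle 1 0 (cos (2 * PI / INR n)) (- sin (2 * PI / INR n))
                 (cos (2 * PI / INR n)) (sin (2 * PI / INR n)) a b).
  { rewrite E2, cos_2a_sin, sin_2a.
    (* For lambda = 0 the complement need not have the eigenvalue 1, so the point 0 is checked
       directly. *)
    destruct (classic (a = 0 /\ b = 0)) as [[-> ->]|H0].
    - split.
      + unfold in_disk, Rdiv.
        assert (/ INR n <= / 2) by (apply Rinv_le_contravar; lra). nra.
      + set (s := sin (PI / INR n)) in *.
        (* Equal coefficients by symmetry; their size comes from cos 2h - 1 = -2 sin^2 h, h =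
           PI/n. *)
        exists (/ (4 * (s * s))), (/ (4 * (s * s))).
        assert (0 < / (4 * (s * s))) by (apply Rinv_0_lt_compat; nra).
        repeat split; try lra; field; lra.
    - assert (HL' := complement_laplacian n L HL).
      assert (Hab' := complement_eigenvalue n L a b Hn HL Hab H0).
      split.
      + assert (Hd := eigenvalue_disk n _ _ _ Hn HL' Hab').
        unfold in_disk in *. lra.
      + destruct (eigenvalue_angle n _ _ _ Hn HL' Hab') as (s & t & Hs0 & Ht0 & Ea & Eb).
        rewrite cos_shift in Ea. rewrite sin_shift in Eb.
        set (u := sin (PI / INR n)) in *. set (v := cos (PI / INR n)) in *.
        assert (Hi : 0 < / (2 * u)) by (apply Rinv_0_lt_compat; lra).
        (* The map z -> 1 - z swaps the two edges, and the spanning vectors at 1 are [2 * u] times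
           the unit vectors (-u, -v) and (-u, v). *)
        exists (t / (2 * u)), (s / (2 * u)).
        split; [apply Rmult_le_pos; lra|]. split; [apply Rmult_le_pos; lra|].
        split.
        * replace a with (1 - (s + t) * u) by lra. field. lra.
        * replace b with ((s - t) * v) by lra. field. lra. }
  destruct Hcompl as [Hd1 Ha1].
  split; [assumption|]. split; [apply (eigenvalue_disk n L); assumption|].
  split; [assumption|]. split; [apply (eigenvalue_angle n L); assumption|].
  apply (eigenvalue_band n L a b); assumption.
Qed.
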